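(* Suppose that $\Xi=\{\xi_q\}\times\{0,1\}^{m_2}$ for a fixed $\xi_q\in\mathbb{R}^{m_1}$, $p\in[1,\infty)$, and $\theta\in[1,\sqrt[p]{2})$. Then for every $x\in\mathcal X$, $$\mathcal Z(x)=\frac1N\sum_{j\in[N]}\max_{i\in[m_2+1]}\min_{y\in\mathbb{R}^{n_2}}\left\{(Q\xi_q+q)^\top y:\ T(x)\hat\zeta_T^{ij}+Wy\ge h(x)\right\},$$ where for each $i\in[m_2+1]$ and $j\in[N]$, $$\hat\zeta_T^{ij}=\zeta_T^j+\begin{cases}0,&\text{if }i=m_2+1,\\ e_i,&\text{if }i\in\mathcal C_0(\zeta_T^j),\\ -e_i,&\text{if }i\in\mathcal C_1(\zeta_T^j),\end{cases}$$ with $\mathcal C_0(\zeta_T^j)=\{t\in[m_2]:\zeta_{Tt}^j=0\}$, $\mathcal C_1(\zeta_T^j)=\{t\in[m_2]:\zeta_{Tt}^j=1\}$, and $e_i$ the $i$th standard basis vector of $\mathbb{R}^{m_2}$.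
   Context: Setting. $[k]=\{1,\dots,k\}$. Let $n_1,n_2,m_1,m_2,\ell,N$ be positive integers, $\mathcal X\subseteq\mathbb{R}^{n_1}$, $c\in\mathbb{R}^{n_1}$, $W\in\mathbb{R}^{\ell\times n_2}$, $Q\in\mathbb{R}^{n_2\times m_1}$, $q\in\mathbb{R}^{n_2}$ fixed, and let $h:\mathbb{R}^{n_1}\to\mathbb{R}^{\ell}$ and $T:\mathbb{R}^{n_1}\to\mathbb{R}^{\ell\times m_2}$ be affine. The support is $\Xi=\Xi_q\times\Xi_T$ with $\Xi_q\subseteq\mathbb{R}^{m_1}$, $\Xi_T\subseteq\mathbb{R}^{m_2}$. For $\xi=(\xi_q,\xi_T)\in\Xi$ the recourse function is $$Z(x,\xi)=\min_{y\in\mathbb{R}^{n_2}}\{(Q\xi_q+q)^\top y:\ T(x)\xi_T+Wy\ge h(x)\}.$$ Minima are read as infima, equal to $+\infty$ if infeasible. Ambiguity set. Given $p\in[1,\infty]$, $\theta\ge0$ and points $\zeta^j=(\zeta_q^j,\zeta_T^j)\in\Xi$, $j\in[N]$, let $\mathbb{P}_{\tilde\zeta}$ be the empirical distribution putting mass $1/N$ on each $\zeta^j$. Let $W^\infty(\mathbb{P}_1,\mathbb{P}_2)$ be the infimum, over all joint distributions $\mathbb{Q}$ of $(\tilde\xi_1,\tilde\xi_2)$ with marginals $\mathbb{P}_1,\mathbb{P}_2$, of the $\mathbb{Q}$-essential supremum of $\|\tilde\xi_1-\tilde\xi_2\|_p$, where $\|\cdot\|_p$ is the $\ell_p$ norm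 on $\mathbb{R}^{m_1+m_2}$. Let $\mathcal P=\{\mathbb{P}:\mathbb{P}(\tilde\xi\in\Xi)=1,\ W^\infty(\mathbb{P},\mathbb{P}_{\tilde\zeta})\le\theta\}$ and $\mathcal Z(x)=\sup_{\mathbb{P}\in\mathcal P}\mathbb{E}_{\mathbb{P}}[Z(x,\tilde\xi)]$. Standing assumption (sufficiently expensive recourse). For all $x\in\mathcal X$ and $\xi\in\Xi$ the dual of the recourse problem is feasible, i.e. there is $\pi\in\mathbb{R}_+^\ell$ with $W^\top\pi=Q\xi_q+q$. *)

(* Defs.v *)
From HB Require Import structures.
From mathcomp Require Import all_boot all_order all_algebra.
From mathcomp Require Import all_classical all_reals all_analysis ess_sup_inf.

Set Implicit Arguments.
Unset Strict Implicit.
Unset Printing Implicit Defensive.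

Import Order.TTheory GRing.Theory Num.Theory.
Import numFieldNormedType.Exports.

Local Open Scope classical_set_scope.
Local Open Scope ring_scope.

(* Vectors of R^n are columns 'cV[R]_n. A random vector xi = (xi_q, xi_T) of
   R^(m1 + m2) is a column of height m1 + m2 whose blocks xi_q and xi_T are
   [usubmx xi] and [dsubmx xi]. *)

Definition borel_matrix_display : measure_display.
Proof. exact: default_measure_display. Qed.

Section borel_matrix.
Context (R : realType) (m n : nat).
Let borel := @open 'M[R]_(m, n).

HB.instance Definition _ := @isMeasurable.Build borel_matrix_display
  'M[R]_(m, n) <<s borel >> (@sigma_algebra0 _ setT borel) (@sigma_algebraC _ borel)
  (@sigma_algebra_bigcup _ setT borel).

End borel_matrix.

Definition affine (R : realType) (U V : lmodType R) (f : U -> V) : Prop :=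
  exists (g : {linear U -> V}) (b : V), forall u, f u = g u + b.

Definition lp_norm (R : realType) (n : nat) (p : R) (v : 'cV[R]_n) : R :=
  (\sum_(i < n) `|v i ord0| `^ p) `^ p^-1.

Section empirical.
Context d (T : measurableType d) (R : realType) (N : nat) (zeta : 'I_N -> T).
Local Open Scope ereal_scope.

Definition empirical (A : set T) : \bar R :=
  (N%:R^-1)%:E * \sum_(j < N) \d_(zeta j) A.

Let empirical0 : empirical set0 = 0.
Proof. by rewrite /empirical big1 ?mule0// => j _; rewrite measure0. Qed.

Let empirical_ge0 A : 0 <= empirical A.
Proof.
by apply: mule_ge0; [rewrite lee_fin invr_ge0 ler0n | exact: sume_ge0].
Qed.

Let empirical_sigma_additive : semi_sigma_additive empirical.
Proof.
move=> F mF tF mUF.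
have N0 : (0 <= N%:R^-1 :> R)%R by rewrite invr_ge0 ler0n.
pose m (k : nat) : {measure set T -> \bar R} :=
  if insub k is Some j then \d_(zeta j) else mzero.
have E A : empirical A = mscale (NngNum N0) (msum m N) A.
  rewrite /mscale /msum /=; congr (_ * _); apply: eq_bigr => j _.
  by rewrite /m valK.
rewrite E (_ : (fun n => _) = (fun n =>
  \sum_(0 <= i < n) mscale (NngNum N0) (msum m N) (F i))); last first.
  by apply/funext => n; apply: eq_bigr => i _; rewrite E.
exact: measure_semi_sigma_additive.
Qed.

HB.instance Definition _ := isMeasure.Build _ _ _ empirical
  empirical0 empirical_ge0 empirical_sigma_additive.

End empirical.

Definition coupling d (T : measurableType d) (R : realType)
    (P1 P2 : {measure set T -> \bar R}) : set (probability (T * T)%type R) :=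
  [set Q | forall A, measurable A ->
    pushforward Q fst A = P1 A /\ pushforward Q snd A = P2 A].

Definition Winfty (R : realType) (n : nat) (p : R)
    (P1 P2 : {measure set 'cV[R]_n -> \bar R}) : \bar R :=
  ereal_inf [set ess_sup Q (fun z => (lp_norm p (z.1 - z.2))%:E)
            | Q in coupling P1 P2].

Definition product_support (R : realType) (m1 m2 : nat)
    (Xi_q : set 'cV[R]_m1) (Xi_T : set 'cV[R]_m2) : set 'cV[R]_(m1 + m2) :=
  [set xi | Xi_q (usubmx xi) /\ Xi_T (dsubmx xi)].

Definition binary (R : realType) (n : nat) : set 'cV[R]_n :=
  [set v | forall i, v i ord0 = 0 \/ v i ord0 = 1].
Arguments binary : clear implicits.

(* The minimum is an infimum in \bar R: +oo when infeasible. *)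
Definition recourse_min (R : realType) (n1 n2 m1 m2 l : nat)
    (h : 'cV[R]_n1 -> 'cV[R]_l) (T : 'cV[R]_n1 -> 'M[R]_(l, m2))
    (W : 'M[R]_(l, n2)) (Q : 'M[R]_(n2, m1)) (q : 'cV[R]_n2)
    (x : 'cV[R]_n1) (xi_q : 'cV[R]_m1) (xi_T : 'cV[R]_m2) : \bar R :=
  ereal_inf [set (((Q *m xi_q + q)^T *m y) ord0 ord0)%:E | y in
    [set y : 'cV[R]_n2 |
      forall k, h x k ord0 <= (T x *m xi_T + W *m y) k ord0]].

Definition recourse (R : realType) (n1 n2 m1 m2 l : nat)
    (h : 'cV[R]_n1 -> 'cV[R]_l) (T : 'cV[R]_n1 -> 'M[R]_(l, m2))
    (W : 'M[R]_(l, n2)) (Q : 'M[R]_(n2, m1)) (q : 'cV[R]_n2)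
    (x : 'cV[R]_n1) (xi : 'cV[R]_(m1 + m2)) : \bar R :=
  recourse_min h T W Q q x (usubmx xi) (dsubmx xi).

Definition sufficiently_expensive_recourse (R : realType) (n1 n2 m1 m2 l : nat)
    (X : set 'cV[R]_n1) (Xi : set 'cV[R]_(m1 + m2))
    (W : 'M[R]_(l, n2)) (Q : 'M[R]_(n2, m1)) (q : 'cV[R]_n2) : Prop :=
  forall x xi, X x -> Xi xi ->
    exists pi : 'cV[R]_l, (forall k, 0 <= pi k ord0) /\
      W^T *m pi = Q *m usubmx xi + q.

Definition ambiguity (R : realType) (n N : nat) (Xi : set 'cV[R]_n)
    (p theta : R) (zeta : 'I_N -> 'cV[R]_n) : set (probability 'cV[R]_n R) :=
  [set P : probability 'cV[R]_n R | P Xi = 1%E /\ (Winfty p P (empirical R zeta) <= theta%:E)%E].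

(* The recourse function is only meaningful on Xi, which has mass 1 under every
   P in the ambiguity set, so the expectation is taken over Xi. *)
Definition worst_case_expectation (R : realType) (n1 n2 m1 m2 l N : nat)
    (h : 'cV[R]_n1 -> 'cV[R]_l) (T : 'cV[R]_n1 -> 'M[R]_(l, m2))
    (W : 'M[R]_(l, n2)) (Q : 'M[R]_(n2, m1)) (q : 'cV[R]_n2)
    (Xi : set 'cV[R]_(m1 + m2)) (p theta : R)
    (zeta : 'I_N -> 'cV[R]_(m1 + m2)) (x : 'cV[R]_n1) : \bar R :=
  ereal_sup [set (\int[P]_(xi in Xi) recourse h T W Q q x xi)%E
            | P in ambiguity Xi p theta zeta].

Definition C0 (R : realType) (n : nat) (z : 'cV[R]_n) : {set 'I_n} :=
  finset (fun t => z t ord0 == 0).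

Definition C1 (R : realType) (n : nat) (z : 'cV[R]_n) : {set 'I_n} :=
  finset (fun t => z t ord0 == 1).

(* The n + 1 indices are split into the n coordinates (inl) and the extra last
   index (inr); the innermost default 0 is never reached when z is binary. *)
Definition flip (R : realType) (n : nat) (z : 'cV[R]_n) (i : 'I_(n + 1)) :
    'cV[R]_n :=
  z + match fintype.split i with
      | inl t => if t \in C0 z then delta_mx t ord0
                 else if t \in C1 z then - delta_mx t ord0 else 0
      | inr _ => 0
      end.

(* Main.v *)
(* On binary vectors, an l_p distance below 2^(1/p) forces agreement up to one
   coordinate. If W^oo(P, empirical) <= theta < 2^(1/p), some coupling has
   essential supremum below 2^(1/p), so it only charges pairs
   (flip zeta^j, zeta^j), which bounds the expectation under P. Conversely,
   moving each atom zeta^j to a maximizing flip costs at most 1 <= theta. Weak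
   duality rules out the value -oo, so that finite sums in the extended reals are well behaved. *)

From HB Require Import structures.
Require Import Defs.
From mathcomp Require Import all_boot all_order all_algebra.
From mathcomp Require Import all_classical all_reals all_analysis ess_sup_inf.
From mathcomp Require Import ring.

Set Implicit Arguments.
Unset Strict Implicit.
Unset Printing Implicit Defensive.

Import Order.TTheory GRing.Theory Num.Theory.
Import numFieldNormedType.Exports.

Local Open Scope classical_set_scope.
Local Open Scope ring_scope.

(** * Measures and integrals over finitely many points *)

Lemma measurable_set1_cV (R : realType) (n : nat) (v : 'cV[R]_n) :
  measurable [set v].
Proof.
rewrite -(setCK [set v]); apply: measurableC; apply: sub_sigma_algebra.
rewrite openC; apply: accessible_closed_set1.
by apply: hausdorff_accessible; exact: norm_hausdorff.
Qed.

Lemma measurable_range_finType d (T : measurableType d) (I : finType)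
    (e : I -> T) : (forall i, measurable [set e i]) -> measurable (range e).
Proof.
move=> me; have -> : range e = \bigcup_(i in [set: I]) [set e i].
  by apply/seteqP; split => [_ [i _ <-]|_ [i _ ->]]; exists i.
by apply: fin_bigcup_measurable => //; exact: finite_finset.
Qed.

Section finitely_supported.
Context d (T : measurableType d) (R : realType) (I : finType) (e : I -> T).
Hypothesis e_inj : injective e.
Hypothesis me : forall i, measurable [set e i].

Let range_bigsetU : range e = \big[setU/set0]_(i <- index_enum I) [set e i].
Proof.
rewrite -bigcup_seq.
apply/seteqP; split => [_ [i _ <-]|_ [i _ ->]]; exists i => //=.
by rewrite mem_index_enum.
Qed.

Let trivIset_range (J : set I) : trivIset J (fun i => [set e i]).
Proof. by move=> i j _ _ [_ [-> /e_inj]]. Qed.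

Local Open Scope ereal_scope.

(** Every function is measurable on [range e], a finite disjoint union of measurable singletons, so
    the integral splits over the atoms. *)
Lemma ge0_integral_range (mu : {measure set T -> \bar R}) (f : T -> \bar R) :
  (forall x, 0 <= f x) ->
  \int[mu]_(x in range e) f x = \sum_(i : I) mu [set e i] * f (e i).
Proof.
move=> f0; rewrite range_bigsetU ge0_integral_bigsetU//.
- apply: eq_bigr => i _.
  rewrite muleC -integral_cst//; apply: eq_integral.
  by move=> x; rewrite inE => ->.
- exact: index_enum_uniq.
- rewrite -range_bigsetU => mD B mB.
  have -> : range e `&` f @^-1` B =
      \bigcup_(i in [set i | B (f (e i))]) [set e i].
    apply/seteqP; split => [_ [[i _ <-] ?]|_ [i ? ->]]; first by exists i.
    by split => //; exists i.
  by apply: fin_bigcup_measurable => //; exact: finite_finset.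
Qed.

(** Finite atom masses and values above [-oo] keep the negative part finite, so the two sums
    recombine termwise even where [f] is [+oo]. *)
Lemma integral_range (mu : {finite_measure set T -> \bar R}) (f : T -> \bar R) :
  (forall i, -oo < f (e i)) ->
  \int[mu]_(x in range e) f x = \sum_(i : I) mu [set e i] * f (e i).
Proof.
move=> fNy; rewrite integralE !ge0_integral_range//.
have fine_mu i : mu [set e i] \is a fin_num by exact: fin_num_measure.
have fine_neg i : f^\- (e i) \is a fin_num.
  move: (fNy i); rewrite funenegE; case: (f (e i)) => [r _||_] //.
    by rewrite /maxe/= ; case: ifP.
  by rewrite /= max_r.
rewrite -fin_num_sumeN; last by move=> i _; rewrite fin_numM ?fine_mu ?fine_neg.
rewrite -big_split/=; apply: eq_bigr => i _.
rewrite -muleN -muleDr//; last by rewrite fin_num_adde_defl// fin_numN.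
by rewrite {3}(funeposneg f).
Qed.

End finitely_supported.

(** Up to a null set, [A] is the disjoint union of its slices over the points [e i]. With [f] a
    projection, this expands the marginals of a coupling. *)
Lemma measure_fibers d (T : measurableType d) d' (U : measurableType d')
    (R : realType) (mu : {measure set T -> \bar R}) (f : T -> U)
    (I : finType) (e : I -> U) (A : set T) :
  measurable_fun setT f -> injective e -> (forall i, measurable [set e i]) ->
  mu (f @^-1` (~` range e)) = 0%E -> measurable A ->
  mu A = (\sum_(i : I) mu (A `&` f @^-1` [set e i]))%E.
Proof.
move=> mf e_inj me mu0 mA.
have mpre B : measurable B -> measurable (f @^-1` B).
  by move=> mB; rewrite -[_ @^-1` _]setTI; exact: mf.
have mr : measurable (range e) by exact: measurable_range_finType.
rewrite -[in LHS](setIT A) -[in LHS](setUv (f @^-1` range e)) setIUr.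
have mc : measurable (f @^-1` (~` range e)) by apply: mpre; exact: measurableC.
rewrite preimage_setC measureU0; first last.
- apply/eqP; rewrite eq_le measure_ge0 andbT -mu0.
  by apply: le_measure; rewrite ?inE//; exact: measurableI.
- exact: measurableI.
- by apply: measurableI => //; exact: mpre.
have -> : A `&` f @^-1` range e =
    \bigcup_(i in [set: I]) (A `&` f @^-1` [set e i]).
  apply/seteqP; split => [x [Ax [i _ ei]]|x [i _ [Ax fx]]].
    by exists i.
  by split => //; exists i => //; rewrite fx.
rewrite measure_fin_bigcup//.
- rewrite [RHS]fsbig_seq ?index_enum_uniq//; apply: eq_fsbigl.
  by apply/seteqP; split => i //= _; rewrite mem_index_enum.
- exact: finite_finset.
- by move=> i j _ _ [x [[_ /= ->] [_ /= /e_inj]]].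
- by move=> i _; apply: measurableI => //; exact: mpre.
Qed.

(** * Empirical measures as finite averages *)

Section empirical_probability.
Context d (T : measurableType d) (R : realType) (N : nat).
Local Open Scope ereal_scope.

Lemma empirical_total (N_gt0 : (0 < N)%N) (z : 'I_N -> T) (A : set T) :
  (forall j, A (z j)) -> empirical R z A = 1.
Proof.
move=> Az; rewrite /empirical (eq_bigr (cst 1)); last first.
  by move=> j _; rewrite diracE mem_set.
by rewrite sumEFin -EFinM sumr_const card_ord mulVf// pnatr_eq0 -lt0n.
Qed.

(** The total mass is 1 only for positive [N], so the probability structure is packed from a proof
    of positivity. *)
Definition empirical_probability (N_gt0 : (0 < N)%N) (z : 'I_N -> T) :
    probability T R :=
  HB.pack_for (probability T R) (empirical R z)
    (Measure_isProbability.Build _ _ _ (empirical R z)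
      (empirical_total N_gt0 (fun j => I : [set: T] (z j)))).

(** Each [z j] is exactly one [e i], so after exchanging the sums one Dirac term survives per [j].
    The weights are nonnegative, which makes distributing them safe for infinite values of [F]. *)
Lemma sum_empirical (I : finType) (e : I -> T) (z : 'I_N -> T)
    (F : T -> \bar R) :
  injective e -> (forall j, range e (z j)) ->
  \sum_(i : I) empirical R z [set e i] * F (e i) =
  \sum_(j < N) (N%:R^-1)%:E * F (z j).
Proof.
move=> e_inj ze; rewrite /empirical.
under eq_bigr => i _.
  rewrite ge0_sume_distrr; last by move=> j _; exact: measure_ge0.
  rewrite ge0_sume_distrl; last first.
    by move=> j _; rewrite mule_ge0// lee_fin invr_ge0.
  over.
rewrite exchange_big/=; apply: eq_bigr => j _.
have [i _ eij] := ze j; rewrite (bigD1 i)//= big1 ?adde0 => [|k ki].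
  by rewrite diracE mem_set ?mule1// eij.
rewrite diracE memNset ?mule0 ?mul0e//= -eij => /e_inj ik.
by rewrite ik eqxx in ki.
Qed.

Lemma mule_sum_weight (F : 'I_N -> \bar R) :
  (forall j, -oo < F j) ->
  \sum_(j < N) (N%:R^-1)%:E * F j = (N%:R^-1)%:E * \sum_(j < N) F j.
Proof.
move=> FNy; rewrite fin_num_sume_distrr// => i j _ _.
by apply: ltninfty_adde_def; rewrite inE.
Qed.

End empirical_probability.

(** * The norm threshold and single-coordinate flips *)

Section lp_norm.
Context (R : realType) (n : nat) (p : R).
Hypothesis p_gt0 : 0 < p.
Implicit Type v : 'cV[R]_n.

(** Two entries of modulus 1 already contribute 2 to the sum of $p$-th powers; this is the source of
    the threshold $2^{1/p}$. *)
Lemma two_powR_le_lp_norm v i j : i != j ->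
  `|v i ord0| = 1 -> `|v j ord0| = 1 -> 2 `^ p^-1 <= lp_norm p v.
Proof.
move=> ij vi vj; apply: ge0_ler_powR; rewrite ?nnegrE ?invr_ge0 ?(ltW p_gt0)//.
  by apply: sumr_ge0 => k _; exact: powR_ge0.
rewrite (bigD1 i)//= (bigD1 j) 1?eq_sym//= vi vj powR1 addrA lerDl.
by apply: sumr_ge0 => k _; exact: powR_ge0.
Qed.

Lemma lp_norm_le1 v i : (forall j, j != i -> v j ord0 = 0) ->
  `|v i ord0| <= 1 -> lp_norm p v <= 1.
Proof.
move=> v0 vi; rewrite /lp_norm (bigD1 i)//= big1 ?addr0; last first.
  by move=> j ji; rewrite v0// normr0 powR0// gt_eqF.
by rewrite -powRrM mulfV ?gt_eqF// powRr1.
Qed.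

End lp_norm.

Section binary_flip.
Context (R : realType) (n : nat).
Implicit Types v w z : 'cV[R]_n.

(** The factor [1 - 2 * z t ord0] is 1 at a zero entry and -1 at a one, which merges the cases of
    [flip] into one formula. *)
Lemma flip_lshift z t : binary R n z ->
  flip z (lshift 1 t) = z + (1 - 2 * z t ord0) *: delta_mx t ord0.
Proof.
move=> /(_ t) zt; rewrite /flip /C0 /C1.
case: fintype.splitP => [k /= tk|k /= tk]; last first.
  by have := ltn_ord t; rewrite tk ltnNge leq_addr.
rewrite -(val_inj tk : t = k) !inE.
by case: zt => ->; rewrite ?eqxx ?oner_eq0; congr (_ + _);
  rewrite ?mulr0 ?subr0 ?scale1r// mulr1 (_ : 1 - 2 = -1) ?scaleN1r//; ring.
Qed.

Lemma flip_last z : flip z (rshift n ord0) = z.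
Proof.
rewrite /flip; case: fintype.splitP => [k /= nk|k _]; last exact: addr0.
by have := ltn_ord k; rewrite -nk addn0 ltnn.
Qed.

Lemma split_last (i : 'I_(n + 1)) :
  (exists t, i = lshift 1 t) \/ i = rshift n ord0.
Proof.
case: (fintype.splitP i) => [t it|k ik]; [left|right].
  by exists t; apply: val_inj.
by apply: val_inj; rewrite /= ik (ord1 k).
Qed.

Lemma flipE_off z t j : binary R n z -> j != t ->
  flip z (lshift 1 t) j ord0 = z j ord0.
Proof.
by move=> bz jt; rewrite flip_lshift// !mxE (negPf jt) mulr0 addr0.
Qed.

Lemma flipE_on z t : binary R n z ->
  flip z (lshift 1 t) t ord0 = 1 - z t ord0.
Proof. by move=> bz; rewrite flip_lshift// !mxE !eqxx mulr1; ring. Qed.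

Lemma flip_binary z i : binary R n z -> binary R n (flip z i).
Proof.
move=> bz j; have [[t ->]|->] := split_last i; last by rewrite flip_last.
have [->|jt] := eqVneq j t; last by rewrite flipE_off.
by rewrite flipE_on//; have [->|->] := bz t; [right|left]; ring.
Qed.

(** If [v] and [w] differ at [t], the pairwise hypothesis forces agreement elsewhere, and distinct
    binary entries are complementary. If they are equal, the extra index serves. *)
Lemma binary_near_flip v w : binary R n v -> binary R n w ->
  (forall i j, i != j -> v i ord0 = w i ord0 \/ v j ord0 = w j ord0) ->
  exists i, v = flip w i.
Proof.
move=> bv bw vw; have [veqw|vneqw] := eqVneq v w.
  by exists (rshift n ord0); rewrite flip_last.
have [t vt] : exists t, v t ord0 != w t ord0.
  apply: contrapT => /forallNP vw'; case/eqP: vneqw.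
  apply/matrixP => i j; rewrite ord1.
  by have /negP := vw' i; rewrite negbK => /eqP.
exists (lshift 1 t); apply/matrixP => j k; rewrite ord1.
have [->|jt] := eqVneq j t.
  rewrite flipE_on//; move: vt; case: (bv t) => ->; case: (bw t) => ->;
  by rewrite ?eqxx ?subrr ?subr0.
rewrite flipE_off//; have [//|vt'] := vw _ _ jt.
by rewrite vt' eqxx in vt.
Qed.

End binary_flip.

(** * Couplings with an empirical measure *)

Section Winfty_empirical.
Context (R : realType) (n N : nat) (p : R).
Implicit Types y z : 'I_N -> 'cV[R]_n.
Local Open Scope ereal_scope.

(** The witness is the coupling that puts mass $1/N$ on each pair [(y j, z j)]. *)
Lemma Winfty_empirical_le (N_gt0 : (0 < N)%N) y z (theta : R) :
  (forall j, lp_norm p (y j - z j) <= theta)%R ->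
  Winfty p (empirical_probability R N_gt0 y) (empirical R z) <= theta%:E.
Proof.
move=> yz; pose yz2 j := (y j, z j).
apply: (@le_trans _ _ (ess_sup (empirical_probability R N_gt0 yz2)
    (fun u => (lp_norm p (u.1 - u.2))%:E))).
  apply: ereal_inf_lbound; exists (empirical_probability R N_gt0 yz2) => //.
(* [theta] is an essential upper bound: the pairs violating it lie in the complement of [range yz2],
   which is null. *)
apply: ereal_inf_lbound; exists (~` range yz2); split.
- apply: measurableC; apply: measurable_range_finType => j.
  rewrite (_ : [set yz2 j] = [set y j] `*` [set z j]); last first.
    by apply/seteqP; split => [_ ->//|[a b] [/= -> ->]].
  by apply: measurableX; exact: measurable_set1_cV.
- rewrite /= /empirical big1 ?mule0// => j _; rewrite diracE memNset//.
  by apply; exists j.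
- move=> u /= /negP; rewrite -ltNge => u_gt [j _ ju].
  by move: u_gt; rewrite -ju lte_fin ltNge yz.
Qed.

(** Strictness provides a coupling with essential supremum below [r], whether or not the infimum is
    attained. It pairs [P] with the empirical measure only along points closer than [r], where [G]
    dominates [F]. *)
Lemma expectation_le_of_Winfty_lt (I : finType) (e : I -> 'cV[R]_n)
    (P : probability 'cV[R]_n R) z (r : R) (F G : 'cV[R]_n -> \bar R) :
  injective e -> P (range e) = 1 -> (forall j, range e (z j)) ->
  Winfty p P (empirical R z) < r%:E ->
  (forall i k, (lp_norm p (e i - e k) < r)%R -> F (e i) <= G (e k)) ->
  \sum_(i : I) P [set e i] * F (e i) <= \sum_(j < N) (N%:R^-1)%:E * G (z j).
Proof.
move=> e_inj Pe ze /ereal_inf_lt[_ [Q PQ <-] Qr] FG.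
have me i : measurable [set e i] by exact: measurable_set1_cV.
have mr : measurable (range e) by exact: measurable_range_finType.
have fstQ A : measurable A -> Q (fst @^-1` A) = P A.
  by move=> mA; have [] := PQ A mA.
have sndQ A : measurable A -> Q (snd @^-1` A) = empirical R z A.
  by move=> mA; have [] := PQ A mA.
(* A finite transport plan: [Pm] and [zm] identify its row and column sums with the two
   marginals. *)
pose m i k := Q (fst @^-1` [set e i] `&` snd @^-1` [set e k]).
have mpre (f : 'cV[R]_n * 'cV[R]_n -> 'cV[R]_n) A :
    measurable_fun setT f -> measurable A -> measurable (f @^-1` A).
  by move=> mf mA; rewrite -[_ @^-1` _]setTI; exact: mf.
have Pm i : P [set e i] = \sum_k m i k.
  rewrite -fstQ//; apply: (measure_fibers (f := snd) _ e_inj) => //.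
  - apply: etrans (sndQ _ (measurableC mr)) _.
    rewrite /empirical big1 ?mule0// => j _.
    by rewrite diracE memNset// => /(_ (ze j)).
  - exact: mpre.
have zm k : empirical R z [set e k] = \sum_i m i k.
  rewrite -sndQ//; under eq_bigr => i _ do rewrite /m setIC.
  apply: (measure_fibers (f := fst) _ e_inj) => //.
  - apply: etrans (fstQ _ (measurableC mr)) _.
    by rewrite probability_setC// Pe subee.
  - exact: mpre.
have m_near i k : m i k = 0 \/ (lp_norm p (e i - e k) < r)%R.
  have [|far] := ltP (lp_norm p (e i - e k)) r; [by right|left].
  (* A cell at distance at least [r] lies in the null set [B] containing all points where the
     function exceeds its essential supremum. *)
  have [B [mB QB subB]] := ess_sup_ge Q
    (fun u => (lp_norm p (u.1 - u.2))%:E).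
  apply/eqP; rewrite eq_le measure_ge0 andbT -QB; apply: le_measure.
  - by rewrite inE; apply: measurableI; apply: mpre.
  - by rewrite inE.
  - move=> u [/= ui uk]; apply: subB => /=; rewrite ui uk => le_r.
    by have := le_lt_trans le_r Qr; rewrite lte_fin ltNge far.
rewrite -(sum_empirical _ e_inj ze).
under eq_bigr => i _ do rewrite Pm ge0_sume_distrl//.
under [leRHS]eq_bigr => k _ do rewrite zm ge0_sume_distrl//.
rewrite [leRHS]exchange_big/=; apply: lee_sum => i _; apply: lee_sum => k _.
(* A null cell contributes 0 on both sides, even where [F] or [G] is infinite. *)
have [->|near] := m_near i k; first by rewrite !mul0e.
by apply: lee_wpmul2l; [exact: measure_ge0|exact: FG].
Qed.

End Winfty_empirical.

(** * Geometry of the binary support *)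

Section binary_support.
Context (R : realType) (m1 m2 : nat) (xi_q : 'cV[R]_m1).

(** Indexing by the finite type of bit vectors makes the support the range of an injection, so
    integrals over it become finite sums. *)
Definition binary_point (b : {ffun 'I_m2 -> bool}) : 'cV[R]_(m1 + m2) :=
  col_mx xi_q (\col_i (b i)%:R).

Lemma binary_point_inj : injective binary_point.
Proof.
move=> b c /eq_col_mx[_ /colP bc]; apply/ffunP => i.
have := bc i; rewrite !mxE => /eqP; rewrite eqr_nat.
by case: (b i) (c i) => -[].
Qed.

Lemma range_binary_point :
  range binary_point = product_support [set xi_q] (binary R m2).
Proof.
apply/seteqP; split => [_ [b _ <-]|v [/= vq vT]].
  split; rewrite /= ?col_mxKu// col_mxKd => i; rewrite mxE.
  by case: (b i); [right|left].
exists [ffun i => dsubmx v i ord0 == 1] => //.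
rewrite -[RHS]vsubmxK vq; congr col_mx; apply/colP => i.
by rewrite mxE ffunE; case: (vT i) => ->; rewrite ?eqxx// eq_sym oner_eq0.
Qed.

(** Distinct binary entries differ by modulus 1, so two disagreeing coordinates would push the norm
    to at least $2^{1/p}$. *)
Lemma binary_point_near_flip (p : R) v w : 0 < p ->
  product_support [set xi_q] (binary R m2) v ->
  product_support [set xi_q] (binary R m2) w ->
  lp_norm p (v - w) < 2 `^ p^-1 ->
  exists i, dsubmx v = flip (dsubmx w) i.
Proof.
move=> p0 [_ bv] [_ bw] vw; apply: binary_near_flip => // i j ij.
apply: contrapT => /not_orP[vwi vwj]; move: vw; rewrite ltNge => /negP; apply.
have norm1 k : dsubmx v k ord0 <> dsubmx w k ord0 ->
    `|(v - w) (rshift m1 k) ord0| = 1.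
  move: (bv k) (bw k); rewrite !mxE => -[->|->] [->|->] //.
    by rewrite sub0r normrN1.
  by rewrite subr0 normr1.
apply: (two_powR_le_lp_norm p0 _ (norm1 _ vwi) (norm1 _ vwj)).
by rewrite (inj_eq (@rshift_inj _ _)).
Qed.

(** The first blocks cancel and the second blocks differ in at most one entry, by modulus 1. *)
Lemma lp_norm_flip_le1 (p : R) w i : 0 < p -> (0 < m2)%N ->
  product_support [set xi_q] (binary R m2) w ->
  lp_norm p (col_mx xi_q (flip (dsubmx w) i) - w) <= 1.
Proof.
move=> p0 m2_gt0 [/= wq bw]; rewrite -{2}(vsubmxK w) wq.
rewrite opp_col_mx add_col_mx subrr.
have [[t ->]|->] := split_last i; last first.
  rewrite flip_last subrr col_mx0.
  (* The difference is zero here; [m2_gt0] supplies a coordinate at which to apply the bound. *)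
  by apply: (lp_norm_le1 p0 (i := rshift m1 (Ordinal m2_gt0))) => [j _|];
    rewrite mxE ?normr0.
apply: (lp_norm_le1 p0 (i := rshift m1 t)) => [j|].
  case: (fintype.split_ordP j) => k -> kt; first by rewrite col_mxEu mxE.
  rewrite col_mxEd [LHS]mxE flipE_off ?mxE ?subrr//.
  by apply: contraNneq kt => ->.
rewrite col_mxEd [X in `|X|]mxE flipE_on// [X in _ + X]mxE.
by case: (bw t) => ->; rewrite ?subr0 ?normr1// subrr sub0r normrN1.
Qed.

End binary_support.

(** * Duality bound, attained maxima and the two inequalities *)

Lemma recourse_min_gtNy (R : realType) (n1 n2 m1 m2 l : nat)
    (h : 'cV[R]_n1 -> 'cV[R]_l) (T : 'cV[R]_n1 -> 'M[R]_(l, m2))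
    (W : 'M[R]_(l, n2)) (Q : 'M[R]_(n2, m1)) (q : 'cV[R]_n2)
    (x : 'cV[R]_n1) (xi_q : 'cV[R]_m1) (xi_T : 'cV[R]_m2) (pi : 'cV[R]_l) :
  (forall k, 0 <= pi k ord0) -> W^T *m pi = Q *m xi_q + q ->
  (-oo < recourse_min h T W Q q x xi_q xi_T)%E.
Proof.
move=> pi0 Wpi; rewrite /recourse_min -Wpi.
(* Weak duality: every feasible [y] satisfies $\pi^\top W y \ge \pi^\top(h(x)-T(x)\xi_T)$, a real
   bound free of [y]. *)
apply: (@lt_le_trans _ _ ((pi^T *m (h x - T x *m xi_T)) ord0 ord0)%:E).
  exact: ltNyr.
apply: le_ereal_inf_tmp => _ [y hy <-]; rewrite lee_fin trmx_mul trmxK -mulmxA.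
rewrite !mxE; apply: ler_sum => k _; rewrite mxE ler_wpM2l ?pi0//.
by have := hy k; rewrite !mxE lerBlDl.
Qed.

(** The default [-oo] lies below every value and there is at least one index, so some index realizes
    the maximum. *)
Lemma bigmaxe_attained (R : realType) (n : nat) (F : 'I_(n + 1) -> \bar R) :
  exists i, \big[maxe/-oo%E]_(i < n + 1) F i = F i.
Proof.
have [i _ Fi] := @eq_bigmax _ _ _ -oo%E (rshift n ord0) predT F isT
  (fun i _ => leNye (F i)).
by exists i.
Qed.

Theorem theorem6 (R : realType) (n1 n2 m1 m2 l N : nat)
    (n1_gt0 : (0 < n1)%N) (n2_gt0 : (0 < n2)%N) (m1_gt0 : (0 < m1)%N)
    (m2_gt0 : (0 < m2)%N) (l_gt0 : (0 < l)%N) (N_gt0 : (0 < N)%N)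
    (X : set 'cV[R]_n1)
    (W : 'M[R]_(l, n2)) (Q : 'M[R]_(n2, m1)) (q : 'cV[R]_n2)
    (h : 'cV[R]_n1 -> 'cV[R]_l) (T : 'cV[R]_n1 -> 'M[R]_(l, m2))
    (h_affine : affine h) (T_affine : affine T)
    (xi_q : 'cV[R]_m1) (Xi : set 'cV[R]_(m1 + m2))
    (Xi_def : Xi = product_support [set xi_q] (binary R m2))
    (p : R) (p_ge1 : 1 <= p)
    (theta : R) (theta_ge1 : 1 <= theta) (theta_lt : theta < 2 `^ p^-1)
    (zeta : 'I_N -> 'cV[R]_(m1 + m2)) (zeta_Xi : forall j, Xi (zeta j))
    (recourse_expensive : sufficiently_expensive_recourse X Xi W Q q)
    (x : 'cV[R]_n1) (x_X : X x) :
  worst_case_expectation h T W Q q Xi p theta zeta x =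
  ((N%:R^-1)%:E * \sum_(j < N) \big[maxe/-oo]_(i < m2 + 1)
     recourse_min h T W Q q x xi_q (flip (dsubmx (zeta j)) i))%E.
Proof.
have p_gt0 : 0 < p by exact: lt_le_trans p_ge1.
(* One sample point yields a multiplier valid for every [xi_T], since the dual constraint involves
   only the fixed block [xi_q]. *)
have [pi [pi0 Wpi]] : exists pi : 'cV[R]_l, (forall k, 0 <= pi k ord0) /\
    W^T *m pi = Q *m xi_q + q.
  have zX := zeta_Xi (Ordinal N_gt0); have := recourse_expensive _ _ x_X zX.
  by move: zX; rewrite Xi_def => -[/= -> _].
have gtNy xi_T := recourse_min_gtNy h T x xi_T pi0 Wpi.
pose e := @binary_point R m1 m2 xi_q.
have e_inj : injective e by exact: binary_point_inj.
have XiE : Xi = range e by rewrite range_binary_point.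
have me i : measurable [set e i] by exact: measurable_set1_cV.
have uXi v : Xi v -> usubmx v = xi_q by rewrite Xi_def => -[].
have expectE (P : probability 'cV[R]_(m1 + m2) R) :
    (\int[P]_(xi in Xi) recourse h T W Q q x xi =
     \sum_i P [set e i] * recourse h T W Q q x (e i))%E.
  rewrite XiE integral_range// => i.
  by rewrite /recourse uXi ?gtNy// XiE; exists i.
pose G (w : 'cV_(m1 + m2)) := \big[maxe/-oo%E]_(i < m2 + 1)
  recourse_min h T W Q q x xi_q (flip (dsubmx w) i).
rewrite -mule_sum_weight; last first.
  move=> j.
  by have [i ->] := bigmaxe_attained
    (fun i => recourse_min h T W Q q x xi_q (flip (dsubmx (zeta j)) i)).
apply/eqP; rewrite eq_le; apply/andP; split.
- apply: ge_ereal_sup => _ [P [PXi WP] <-]; rewrite expectE.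
  (* The radius $2^{1/p}$ exceeds [theta] strictly, which turns the non-strict bound [WP] into the
     strict one required. *)
  apply: (@expectation_le_of_Winfty_lt _ _ _ p _ e P zeta (2 `^ p^-1)
    (recourse h T W Q q x) G) => //.
  + by rewrite -XiE.
  + by rewrite -XiE.
  + by apply: le_lt_trans WP _; rewrite lte_fin.
  + move=> i k ik.
    have [eiX ekX] : Xi (e i) /\ Xi (e k) by rewrite XiE; split; eexists.
    rewrite /recourse uXi//; rewrite Xi_def in eiX ekX.
    (* The recourse value at [e i] is thus one of those maximized in [G (e k)]. *)
    have [t ->] := binary_point_near_flip p_gt0 eiX ekX ik.
    exact: (le_bigmax -oo%E
      (fun t => recourse_min h T W Q q x xi_q (flip (dsubmx (e k)) t))).
- have /choice[t maxt] : forall j, exists t,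
      G (zeta j) = recourse_min h T W Q q x xi_q (flip (dsubmx (zeta j)) t).
    by move=> j; exact: bigmaxe_attained.
  (* Each sample point is moved to its worst flip; the empirical measure of the moved points is the
     candidate for the supremum. *)
  pose y j := col_mx xi_q (flip (dsubmx (zeta j)) (t j)).
  have yXi j : Xi (y j).
    rewrite Xi_def; split; first exact: col_mxKu.
    rewrite /= col_mxKd; apply: flip_binary.
    by move: (zeta_Xi j); rewrite Xi_def => -[].
  apply: (@le_trans _ _
    (\int[empirical_probability R N_gt0 y]_(xi in Xi) recourse h T W Q q x xi)%E).
    rewrite expectE sum_empirical// -?XiE//; apply: lee_sum => j _.
    by rewrite -/(G (zeta j)) maxt /recourse col_mxKu col_mxKd.
  apply: ereal_sup_ubound; exists (empirical_probability R N_gt0 y) => //; split.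
    exact: empirical_total.
  (* Each point moves by at most 1, which is where [theta_ge1] enters. *)
  apply: Winfty_empirical_le => j; apply: le_trans theta_ge1.
  by apply: lp_norm_flip_le1 => //; rewrite -Xi_def.
Qed.
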